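(* For $n\geq 0$, $$F_n^I(xq,yq^2,q)=q^nF_n^I(x,y,q)\quad\text{and}\quad F_n^I(x,y,q)=q^{\binom{n}{2}}F_n^I\left(x,\frac{y}{q},1\right).$$
   Context: $S_n(123,132,213)$ is the set of permutations of $[n]$ with no subsequence order isomorphic to $123$, $132$ or $213$; each such $\pi$ is a concatenation of increasing blocks of size $1$ or $2$, each block larger than all later blocks. $s(\pi)$, $d(\pi)$ are the numbers of maximal increasing runs of $\pi$ of length $1$ and $2$, and $inv(\pi)$ is the number of inversions. $F_n^I(x,y,q)=\sum_{\pi\in S_n(123,132,213)}x^{s(\pi)}y^{d(\pi)}q^{inv(\pi)}$; $F_n^I(x,y/q,1)$ denotes the result of substituting $y/q$ for $y$ and $1$ for $q$. *)

(* Defs.v *)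
From mathcomp Require Import all_boot all_fingroup all_algebra.

Set Implicit Arguments.
Unset Strict Implicit.
Unset Printing Implicit Defensive.

(* One-line notation pi(1) ... pi(n), with values shifted from 'I_n to [n]. *)
Definition word (n : nat) (pi : 'S_n) : seq nat :=
  [seq (nat_of_ord (pi i)).+1 | i <- enum 'I_n].

Definition order_iso (u v : seq nat) : bool :=
  (size u == size v) &&
  [forall i : 'I_(size u), forall j : 'I_(size u),
     (nth 0 u i < nth 0 u j) == (nth 0 v i < nth 0 v j)].

(* The subsequences of w are exactly the [mask m w]. *)
Definition contains (w tau : seq nat) : bool :=
  [exists m : (size w).-tuple bool, order_iso (mask m w) tau].

Definition avoids (n : nat) (pats : seq (seq nat)) (pi : 'S_n) : bool :=
  all (fun tau => ~~ contains (word pi) tau) pats.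

Definition av_123_132_213 (n : nat) : {set 'S_n} :=
  [set pi | avoids [:: [:: 1; 2; 3]; [:: 1; 3; 2]; [:: 2; 1; 3]] pi].

(* The maximal increasing runs of consecutive letters, from left to right. *)
Fixpoint runs (w : seq nat) : seq (seq nat) :=
  if w is a :: w' then
    match runs w' with
    | (b :: r) :: rs =>
        if a < b then (a :: b :: r) :: rs else [:: a] :: (b :: r) :: rs
    | _ => [:: [:: a]]
    end
  else [::].

Definition nruns (k n : nat) (pi : 'S_n) : nat :=
  count (fun r => size r == k) (runs (word pi)).

Definition s_stat (n : nat) (pi : 'S_n) : nat := nruns 1 pi.
Definition d_stat (n : nat) (pi : 'S_n) : nat := nruns 2 pi.

Definition inv_stat (n : nat) (pi : 'S_n) : nat :=
  #|[set p : 'I_n * 'I_n | (p.1 < p.2) && (pi p.2 < pi p.1)]|.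

Local Open Scope ring_scope.

(* x, y, q are arbitrary elements of an arbitrary commutative ring, so that
   substitutions are function application; the formal polynomial is the case
   where they are indeterminates. *)
Definition FI (R : comNzRingType) (n : nat) (x y q : R) : R :=
  \sum_(pi in av_123_132_213 n)
     x ^+ s_stat pi * y ^+ d_stat pi * q ^+ inv_stat pi.

Local Close Scope ring_scope.

(* [runs w] is characterised by the following facts. *)
Lemma runs_nonnil w : [::] \notin runs w.
Proof.
elim: w => [//|a w IH] /=; case: (runs w) IH => [|[|b r] rs] //=.
by case: ifP.
Qed.

Lemma flatten_runs w : flatten (runs w) = w.
Proof.
elim: w => [//|a w IH] /=; have := runs_nonnil w.
case: (runs w) IH => [|[|b r] rs] //= <- // _.
by case: ifP.
Qed.

Lemma runs_increasing w : all (sorted ltn) (runs w).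
Proof.
elim: w => [//|a w IH] /=; case: (runs w) IH => [|[|b r] rs] //= /andP[br rs_].
by case: ifP => ab /=; rewrite ?ab br rs_.
Qed.

Lemma runs_maximal w :
  sorted (fun r r' => head 0 r' <= last 0 r) (runs w).
Proof.
elim: w => [//|a w IH] /=; case: (runs w) IH => [|[|b r] rs] //= IH.
case: ifP => ab /=; last by rewrite leqNgt ab.
by case: rs IH.
Qed.

(* Main.v *)
(* If [pi] avoids 123, 132 and 213 and [pi i < pi k] with [i < k], then no
   position lies strictly between [i] and [k], since its value would complete
   one of the three patterns. So the non-inversions of [pi] are its ascents,
   and its runs have length at most 2. The first fact says that [pi] has
   [d pi] non-inversions, i.e. [inv pi + d pi = 'C(n, 2)]; the second that
   [s pi + 2 d pi = n]. Both identities then hold term by term. *)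
Require Import Defs.
From mathcomp Require Import all_boot all_fingroup all_algebra zify ring.
Import GRing.Theory.

Definition ascents (w : seq nat) : nat :=
  \sum_(i < size w) ((i.+1 < size w) && (nth 0 w i < nth 0 w i.+1)).

(** Prepending a letter either creates an ascent and lengthens the first run, or creates no ascent
    and opens a new run. *)
Lemma size_runs_ascents w : size (runs w) + ascents w = size w.
Proof.
elim: w => [|a w IH]; first by rewrite /ascents big_ord0.
(* The possible ascent at position 0 is split off; the shifted sum is convertible to [ascents w]. *)
rewrite /ascents [size (a :: w)]/= big_ord_recl -[\sum_(i < _) _]/(ascents w).
rewrite /= ltnS; move: IH (flatten_runs w) (runs_nonnil w).
case: (runs w) => [|[|b r] rs] //=; first by move=> + w0; rewrite -w0 /=; lia.
by move=> + wE; rewrite -wE /=; case: ifP => /=; lia.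
Qed.

Lemma size_runs_le2 w :
  (forall i, i.+2 < size w -> nth 0 w i.+2 <= nth 0 w i) ->
  all (fun r => size r <= 2) (runs w).
Proof.
elim: w => [//|a w IH] no_far /=.
have {}IH := IH (fun i => no_far i.+1).
move: IH (flatten_runs w) (runs_increasing w).
case: (runs w) => [|[|b r] rs] //= /andP[szr szrs] wE /andP[br _].
case: ifP => ab /=; last by rewrite szr.
(* The critical case is a run starting [b < c] extended by [a < b]: [no_far 0] would give
   [c <= a]. *)
rewrite szrs andbT; case: r br wE {szr} => [//|c r] /= /andP[bc _] wE.
by have := no_far 0; rewrite -wE /=; lia.
Qed.

(** Runs are nonempty, so each has length 1 or 2, and they concatenate to [w]. *)
Lemma runs_le2_count w : all (fun r => size r <= 2) (runs w) ->
  let s := count (fun r => size r == 1) (runs w) in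
  let d := count (fun r => size r == 2) (runs w) in
  s + d = size (runs w) /\ s + d.*2 = size w.
Proof.
move=> le2; rewrite -[in size w](flatten_runs w) /=.
elim: (runs w) (runs_nonnil w) le2 => [//|r rs IH].
rewrite inE negb_or /= size_cat => /andP[r0 rs0] /andP[szr szrs].
have [] := IH rs0 szrs; case: r r0 szr => [//|a [|b [|c r]]] //=; lia.
Qed.

Lemma contains_subseq u w tau :
  subseq u w -> order_iso u tau -> contains w tau.
Proof.
move=> /subseqP[m szm ->] iso.
by apply/existsP; exists (Tuple (introT eqP szm)).
Qed.

(** Reduces a pattern of length three to six comparisons that [lia] can settle. *)
Lemma order_iso3 (a b c x y z : nat) :
  (a < b) = (x < y) -> (b < a) = (y < x) -> (a < c) = (x < z) ->
  (c < a) = (z < x) -> (b < c) = (y < z) -> (c < b) = (z < y) ->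
  order_iso [:: a; b; c] [:: x; y; z].
Proof.
move=> ab ba ac ca bc cb; apply/andP; split=> //.
apply/forallP=> -[[|[|[|i]]] //= ?]; apply/forallP=> -[[|[|[|j]]] //= ?];
  by apply/eqP; rewrite ?ltnn.
Qed.

Lemma subseq_word3 n (pi : 'S_n) (i j k : 'I_n) : i < j -> j < k ->
  subseq [:: (pi i).+1; (pi j).+1; (pi k).+1] (word pi).
Proof.
move=> ij jk; rewrite /word.
have -> : [:: (pi i).+1; (pi j).+1; (pi k).+1] =
  [seq (nat_of_ord (pi i)).+1 | i <- [:: i; j; k]] by [].
apply: map_subseq.
(* Both lists are strictly increasing with the same members, hence equal. *)
rewrite (_ : [:: i; j; k] = filter [in [:: i; j; k]] (enum 'I_n)).
  exact: filter_subseq.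
have tr : transitive (relpre (@nat_of_ord n) ltn).
  by move=> x y z; apply: ltn_trans.
apply: (irr_sorted_eq tr) => [x||| x] /=; rewrite ?ltnn ?ij ?jk //.
  by apply: sorted_filter => //; rewrite -sorted_map val_enum_ord iota_ltn_sorted.
by rewrite mem_filter mem_enum andbT.
Qed.

Lemma av_far_inversion n (pi : 'S_n) (i k : 'I_n) :
  pi \in av_123_132_213 n -> i.+1 < k -> pi k < pi i.
Proof.
rewrite inE => /and4P[n123 n132 n213 _] ik.
have jn : i.+1 < n by apply: ltn_trans (ltn_ord k).
pose j := Ordinal jn; have ij : i < j by []; have jk : j < k by [].
have sub := subseq_word3 n pi i j k ij jk.
have neq (a b : 'I_n) : a < b -> pi a != pi b :> nat.
  by move=> ab; rewrite (inj_eq val_inj) (inj_eq perm_inj) -val_eqE neq_ltn ab.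
have := (neq _ _ ij, neq _ _ jk, neq i k (ltn_trans ij jk)).
case=> -[/eqP nij /eqP njk] /eqP nik; rewrite ltnNge; apply/negP => ltik.
(* Given [pi i < pi k], the value [pi j] lies below both (213), between them (123) or above both
   (132). *)
have [ltij | leji] := ltnP (pi i) (pi j); last first.
  by case/negP: n213; apply: contains_subseq _ _ _ sub _; apply: order_iso3; lia.
have [ltjk | lekj] := ltnP (pi j) (pi k).
  by case/negP: n123; apply: contains_subseq _ _ _ sub _; apply: order_iso3; lia.
by case/negP: n132; apply: contains_subseq _ _ _ sub _; apply: order_iso3; lia.
Qed.

Lemma size_word n (pi : 'S_n) : size (word pi) = n.
Proof. by rewrite size_map size_enum_ord. Qed.

Lemma nth_word n (pi : 'S_n) (i : 'I_n) : nth 0 (word pi) i = (pi i).+1.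
Proof. by rewrite (nth_map i) ?size_enum_ord // nth_ord_enum. Qed.

Lemma card_ord_ltn_pairs n :
  #|[set p : 'I_n * 'I_n | p.1 < p.2]| = 'C(n, 2).
Proof.
rewrite -sum1_card -bin2_sum big_mkord.
under eq_bigl do rewrite inE.
rewrite -(pair_big_dep xpredT (fun i j : 'I_n => i < j) (fun _ _ => 1)) /=.
(* Pairs are counted by their larger entry: [j] has exactly [j] smaller partners. *)
rewrite (exchange_big_dep xpredT) //=; apply: eq_bigr => j _.
by rewrite (big_ord_narrow (ltnW (ltn_ord j))) sum1_card card_ord.
Qed.

Lemma ascents_word n (pi : 'S_n) :
  ascents (word pi) =
  #|[set p : 'I_n * 'I_n | (p.1.+1 == p.2) && (pi p.1 < pi p.2)]|.
Proof.
rewrite /ascents size_word -sum1_card.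
under [RHS]eq_bigl do rewrite inE.
rewrite -(pair_big_dep xpredT
  (fun i j : 'I_n => (i.+1 == j) && (pi i < pi j)) (fun _ _ => 1)) /=.
apply: eq_bigr => i _; case: (ltnP i.+1 n) => [ltin | lein] /=; last first.
  by rewrite big_pred0 // => j; apply/negP => /andP[/eqP]; have := ltn_ord j; lia.
pose j := Ordinal ltin.
rewrite nth_word -[i.+1]/(nat_of_ord j) nth_word ltnS big_mkcondr /=.
(* The inner sum collapses to the single index [j], the successor of [i]. *)
by rewrite (big_pred1 j) => [|k]; [case: ifP | rewrite /= -val_eqE eq_sym].
Qed.

(** The pairs [i < j] split into inversions and non-inversions; by [av_far_inversion] the latter are
    adjacent, hence ascents. *)
Lemma av_inv_ascents n (pi : 'S_n) : pi \in av_123_132_213 n ->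
  inv_stat pi + ascents (word pi) = 'C(n, 2).
Proof.
move=> av; rewrite ascents_word -card_ord_ltn_pairs.
rewrite -(cardsID [set p : 'I_n * 'I_n | pi p.2 < pi p.1]
                  [set p : 'I_n * 'I_n | p.1 < p.2]).
congr (_ + _); apply: eq_card => -[i j]; rewrite !inE //=.
have [-> | neij] := eqVneq i j; first by rewrite !ltnn; lia.
have neq : pi i != pi j :> nat by rewrite (inj_eq val_inj) (inj_eq perm_inj).
have := @av_far_inversion n pi i j av.
by move: neij neq; rewrite -val_eqE /=; lia.
Qed.

(** There are [s + d] runs and [s + 2d = n] letters, so [size_runs_ascents] leaves exactly [d]
    ascents. *)
Lemma av_stats n (pi : 'S_n) : pi \in av_123_132_213 n ->
  s_stat pi + (d_stat pi).*2 = n /\ inv_stat pi + d_stat pi = 'C(n, 2).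
Proof.
move=> av; have := av_inv_ascents n pi av; have := size_runs_ascents (word pi).
have [|] := @runs_le2_count (word pi); last first.
  by rewrite size_word -!/(nruns _ _) -/(s_stat pi) -/(d_stat pi); lia.
apply: size_runs_le2 => i; rewrite size_word => lt2.
have lt0 : i < n by lia.
rewrite -[i.+2]/(nat_of_ord (Ordinal lt2)) -{2}[i]/(nat_of_ord (Ordinal lt0)).
by rewrite !nth_word ltnS ltnW // av_far_inversion /=.
Qed.

Local Open Scope ring_scope.

Theorem theorem4p3 (n : nat) :
  (forall (R : comNzRingType) (x y q : R),
     FI n (x * q) (y * q ^+ 2) q = q ^+ n * FI n x y q)
  /\
  (forall (R : comUnitRingType) (x y q : R), q \is a GRing.unit ->
     FI n x y q = q ^+ 'C(n, 2) * FI n x (y / q) 1).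
Proof.
split=> [R x y q | R x y q qU]; rewrite /FI mulr_sumr; apply: eq_bigr => pi av.
  have [nE _] := av_stats n pi av; rewrite -[in q ^+ n]nE -addnn.
  by rewrite !exprMn !exprD; ring.
have [_ <-] := av_stats n pi av.
(* Inserting [q ^+ d / q ^+ d] completes the power of [q] to [inv + d] and leaves the inverse power
   for [y / q]. *)
rewrite expr1n -[q ^+ inv_stat pi in LHS](mulrK (unitrX (d_stat pi) qU)).
by rewrite exprMn exprVn exprD; ring.
Qed.
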